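(* Let $\mathrm{BS}(1,2)=\langle a,t\mid tat^{-1}=a^2\rangle$ and let $\Gamma$ be the Cayley graph of $\mathrm{BS}(1,2)$ with generating set $\{a,t,\tau\}$, where $\tau=t^2$. Then $\Gamma$ is not shortcut.
   Context: Graphs are $1$-dimensional cell complexes with each edge isometric to $[0,1]$, with geodesic path metric. A cycle $C$ is a graph homeomorphic to a circle; $|C|$ is its number of edges. A cycle in a graph $\Gamma$ is a continuous map $f\colon C\to\Gamma$ sending vertices to vertices and each closed edge onto a closed edge (not necessarily injective). It is isometric if it is an isometric embedding. A connected simplicial graph $\Gamma$ is shortcut if there is $\theta\in\mathbb{N}$ such that every isometric cycle $C\to\Gamma$ has $|C|\le\theta$. *)

(* Defs.v *)
From HB Require Import structures.
From Stdlib Require Import Relations.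
From mathcomp Require Import all_boot all_order all_algebra.
From mathcomp Require Import generic_quotient.
From mathcomp Require Import all_classical all_reals ereal.
From mathcomp Require Import ring lra.

Set Implicit Arguments.
Unset Strict Implicit.
Unset Printing Implicit Defensive.

Import Order.TTheory GRing.Theory Num.Theory.

Local Open Scope classical_set_scope.
Local Open Scope ring_scope.
Local Open Scope quotient_scope.

(** * Graphs as 1-dimensional cell complexes *)

(* An edge [e] is a 1-cell glued to [src e] and [tgt e]; the orientation only
   serves to parametrize it.  Loops and parallel edges are allowed here. *)
Record graph := Graph {
  vert : Type;
  edge : Type;
  src : edge -> vert;
  tgt : edge -> vert }.

Definition simplicial (G : graph) : Prop :=
  (forall e : edge G, src e <> tgt e) /\
  (forall e e' : edge G,
     (src e = src e' /\ tgt e = tgt e') \/ (src e = tgt e' /\ tgt e = src e') ->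
     e = e').

Definition connected_graph (G : graph) : Prop :=
  forall u v : vert G,
    clos_refl_sym_trans _ (fun x y => exists e : edge G, src e = x /\ tgt e = y)
      u v.

Record simplicialGraph := SimplicialGraph {
  sgraph :> graph;
  sgraph_simplicial : simplicial sgraph;
  sgraph_connected : connected_graph sgraph }.

Section Realization.
Variable R : realType.

Definition open_unit := {s : R | 0 < s < 1}.

(* The points of the cell complex: the 0-cells and the points of the open
   1-cells. *)
Inductive point (G : graph) :=
| Vertex of vert G
| Interior of edge G & open_unit.
Arguments Vertex {G}.

(* The characteristic map [0,1] -> |G| of the edge [e] (only meaningful for
   0 <= s <= 1). *)
Definition edge_point (G : graph) (e : edge G) (s : R) : point G :=
  if insub s is Some r then Interior e r
  else if s <= 0 then Vertex (src e) else Vertex (tgt e).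

Definition closed_edge (G : graph) (e : edge G) : set (point G) :=
  [set edge_point e s | s in [set s : R | 0 <= s <= 1]].

(* [polyline x y l]: there is a concatenation of finitely many segments, each
   contained in one closed edge, that goes from [x] to [y] and has total
   length [l]. *)
Inductive polyline (G : graph) : point G -> point G -> R -> Prop :=
| polyline_nil x : polyline x x 0
| polyline_cons e s s' y l :
    0 <= s <= 1 -> 0 <= s' <= 1 -> polyline (edge_point e s') y l ->
    polyline (edge_point e s) y (`|s - s'| + l).

(* The geodesic path metric; it is +oo between distinct components. *)
Definition dist (G : graph) (x y : point G) : \bar R :=
  ereal_inf [set l%:E | l in [set l : R | polyline x y l]].

Definition metric_continuous (X Y : Type) (dX : X -> X -> \bar R)
    (dY : Y -> Y -> \bar R) (f : X -> Y) : Prop :=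
  forall (x : X) (eps : R), 0 < eps ->
  exists2 delta : R, 0 < delta &
    forall y, (dX x y < delta%:E)%E -> (dY (f x) (f y) < eps%:E)%E.

Definition homeomorphic (X Y : Type) (dX : X -> X -> \bar R)
    (dY : Y -> Y -> \bar R) : Prop :=
  exists (f : X -> Y) (g : Y -> X),
    [/\ cancel f g, cancel g f,
        metric_continuous dX dY f & metric_continuous dY dX g].

(* The circle of length 1, i.e. R/Z with its arc length metric. *)
Definition circle := {s : R | 0 <= s < 1}.

Definition circle_dist (p q : circle) : \bar R :=
  (Num.min `|val p - val q| (1 - `|val p - val q|))%:E.

Definition is_cycle (C : graph) : Prop := homeomorphic (@dist C) circle_dist.

Definition cycle_in (C G : graph) (f : point C -> point G) : Prop :=
  [/\ metric_continuous (@dist C) (@dist G) f,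
      forall v : vert C, exists w : vert G, f (Vertex v) = Vertex w
    & forall e : edge C, exists e' : edge G,
        f @` closed_edge e = closed_edge e'].

Definition isometric (C G : graph) (f : point C -> point G) : Prop :=
  forall x y, dist (f x) (f y) = dist x y.

(* The bound |C| <= theta on the number of edges is an inequality of
   cardinals, which in particular says that C has finitely many edges. *)
Definition shortcut (G : simplicialGraph) : Prop :=
  exists theta : nat, forall (C : graph) (f : point C -> point G),
    is_cycle C -> cycle_in f -> isometric f ->
    ([set: edge C] #<= `I_theta)%card.

End Realization.

(** * Groups given by presentations *)

Section Presentation.
Variable X : choiceType.

(* The letter (x, true) stands for x and (x, false) for x^-1. *)
Definition word := seq (X * bool).

Definition inv_word (w : word) : word := rev [seq (l.1, ~~ l.2) | l <- w].

(* [rels] is the set of defining relations u = v. *)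
Variable rels : set (word * word).

Inductive word_eq : word -> word -> Prop :=
| word_eq_refl u : word_eq u u
| word_eq_sym u v : word_eq u v -> word_eq v u
| word_eq_trans u v w : word_eq u v -> word_eq v w -> word_eq u w
| word_eq_cat u u' v v' :
    word_eq u u' -> word_eq v v' -> word_eq (u ++ v) (u' ++ v')
| word_eq_cancel x b : word_eq [:: (x, b); (x, ~~ b)] [::]
| word_eq_rel u v : rels (u, v) -> word_eq u v.

Definition word_eqb : rel word := fun u v => `[< word_eq u v >].

Lemma word_eqb_refl : reflexive word_eqb.
Proof. by move=> u; apply/asboolP; exact: word_eq_refl. Qed.

Lemma word_eqb_sym : symmetric word_eqb.
Proof. by move=> u v; apply/asboolP/asboolP; exact: word_eq_sym. Qed.

Lemma word_eqb_trans : transitive word_eqb.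
Proof.
move=> v u w /asboolP uv /asboolP vw.
by apply/asboolP; exact: word_eq_trans uv vw.
Qed.

Canonical word_equiv := EquivRel word_eqb word_eqb_refl word_eqb_sym word_eqb_trans.

Definition presented := {eq_quot word_eqb}.

HB.instance Definition _ := Choice.on presented.
HB.instance Definition _ := EqQuotient.on presented.

Definition class_of (w : word) : presented := \pi_presented w.

Lemma class_ofP u v : class_of u = class_of v <-> word_eq u v.
Proof.
rewrite /class_of; split=> [/eqmodP/asboolP //|uv].
by apply/eqmodP/asboolP.
Qed.

Lemma repr_eq w : word_eq (repr (class_of w)) w.
Proof. by apply/class_ofP; rewrite /class_of reprK. Qed.

Lemma word_eq_invl w : word_eq (inv_word w ++ w) [::].
Proof.
elim: w => [|[x b] w IH]; first exact: word_eq_refl.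
rewrite /inv_word /= rev_cons cat_rcons -/(inv_word w).
apply: (word_eq_trans (v := inv_word w ++ ([::] ++ w))) => //.
apply: word_eq_cat; first exact: word_eq_refl.
rewrite -[_ :: _]/([:: (x, ~~ b); (x, b)] ++ w).
apply: word_eq_cat; last exact: word_eq_refl.
by rewrite -{2}[b]negbK; exact: word_eq_cancel.
Qed.

Lemma inv_wordK : involutive inv_word.
Proof.
move=> w; rewrite /inv_word map_rev revK -map_comp.
by rewrite map_id_in // => -[x b] _ /=; rewrite negbK.
Qed.

Lemma word_eq_invr w : word_eq (w ++ inv_word w) [::].
Proof. by rewrite -{1}[w]inv_wordK; exact: word_eq_invl. Qed.

Definition presented_mul (g h : presented) := class_of (repr g ++ repr h).
Definition presented_inv (g : presented) := class_of (inv_word (repr g)).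

Lemma class_of_repr g : class_of (repr g) = g.
Proof. exact: reprK. Qed.

Lemma class_of_cat u v :
  presented_mul (class_of u) (class_of v) = class_of (u ++ v).
Proof. by apply/class_ofP/word_eq_cat; exact: repr_eq. Qed.

Lemma presented_mulA : associative presented_mul.
Proof.
move=> g h k; rewrite -[g]class_of_repr -[h]class_of_repr -[k]class_of_repr.
by rewrite !class_of_cat catA.
Qed.

Lemma presented_mul1g : left_id (class_of [::]) presented_mul.
Proof. by move=> g; rewrite -[g]class_of_repr class_of_cat. Qed.

Lemma presented_mulg1 : right_id (class_of [::]) presented_mul.
Proof. by move=> g; rewrite -[g]class_of_repr class_of_cat cats0. Qed.

Lemma presented_mulVg :
  left_inverse (class_of [::]) presented_inv presented_mul.
Proof.
move=> g; rewrite /presented_inv -{2}[g]class_of_repr class_of_cat.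
exact/class_ofP/word_eq_invl.
Qed.

Lemma presented_mulgV :
  right_inverse (class_of [::]) presented_inv presented_mul.
Proof.
move=> g; rewrite /presented_inv -{1}[g]class_of_repr class_of_cat.
exact/class_ofP/word_eq_invr.
Qed.

HB.instance Definition _ := isGroup.Build presented presented_mulA
  presented_mul1g presented_mulg1 presented_mulVg presented_mulgV.

Definition gen (x : X) : presented := class_of [:: (x, true)].

Lemma class_of_inv w : ((class_of w)^-1 = class_of (inv_word w))%g.
Proof.
apply: (@mulgI _ (class_of w)); rewrite mulgV.
by rewrite [RHS]class_of_cat; apply/esym/class_ofP/word_eq_invr.
Qed.

End Presentation.

(** * Cayley graphs *)

Definition cayley (G : groupType) (S : set G) : graph :=
  {| vert := G; edge := (G * S)%type;
     src := fun e => e.1; tgt := fun e => (e.1 * val e.2)%g |}.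

(** * The Baumslag-Solitar group BS(1,2) *)

Variant bs_letter := letter_a | letter_t.

Definition bool_of_letter l := if l is letter_a then true else false.
Definition letter_of_bool (b : bool) := if b then letter_a else letter_t.

Lemma bool_of_letterK : cancel bool_of_letter letter_of_bool.
Proof. by case. Qed.

HB.instance Definition _ := Countable.copy bs_letter (can_type bool_of_letterK).

Definition bs_rels : set (word bs_letter * word bs_letter) :=
  [set ([:: (letter_t, true); (letter_a, true); (letter_t, false)],
        [:: (letter_a, true); (letter_a, true)])].

Definition BS12 : groupType := presented bs_rels.
Definition bs_a : BS12 := gen bs_rels letter_a.
Definition bs_t : BS12 := gen bs_rels letter_t.
Definition bs_tau : BS12 := (bs_t ^+ 2)%g.

Definition bs_gens : set BS12 := [set bs_a; bs_t; bs_tau].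

(* BS(1,2) acts on the rationals, a by x |-> x + 1 and t by x |-> 2x; this
   separates the elements of length at most 2 that matter below. *)
Definition letter_act (l : bs_letter * bool) (x : rat) : rat :=
  match l with
  | (letter_a, true) => x + 1
  | (letter_a, false) => x - 1
  | (letter_t, true) => 2 * x
  | (letter_t, false) => x / 2
  end.

Definition word_act (w : word bs_letter) (x : rat) : rat :=
  foldr letter_act x w.

Lemma word_act_eq u v : word_eq bs_rels u v -> word_act u =1 word_act v.
Proof.
elim=> {u v} [//|u v _ IH x|u v w _ IHu _ IHv x|u u' v v' _ IHu _ IHv x|l b x|].
- by rewrite IH.
- by rewrite IHu.
- by rewrite /word_act !foldr_cat -/(word_act v x) IHv -/(word_act u _) IHu.
- by case: l; case: b => /=; field.
- by move=> u v [-> ->] x /=; field.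
Qed.

Definition bs_act (g : BS12) (x : rat) : rat := word_act (repr g) x.

Lemma bs_act_class w : bs_act (class_of bs_rels w) =1 word_act w.
Proof. exact/word_act_eq/repr_eq. Qed.

Lemma bs_act1 x : bs_act 1%g x = x.
Proof. by rewrite [LHS]bs_act_class. Qed.

Lemma bs_actM g h x : bs_act (g * h)%g x = bs_act g (bs_act h x).
Proof. by rewrite [LHS]bs_act_class /word_act foldr_cat. Qed.

Lemma bs_act_gens (s : BS12) : bs_gens s ->
  [\/ bs_act s =1 (fun x => x + 1), bs_act s =1 (fun x => 2 * x)
    | bs_act s =1 (fun x => 4 * x)].
Proof.
move=> [[->|->]|->].
- by apply: Or31 => x; rewrite bs_act_class.
- by apply: Or32 => x; rewrite bs_act_class.
- by apply: Or33 => x; rewrite /bs_tau expgS expg1 bs_actM !bs_act_class /=; ring.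
Qed.

Lemma bs_cayley_simplicial : simplicial (cayley bs_gens).
Proof.
have act1 s x : s = 1%g :> BS12 -> bs_act s x = x by move=> ->; rewrite bs_act1.
split=> [[g [s /= /set_mem sS]] gs | [g [s sS]] [g' [s' sS']] /=].
  have s1 : s = 1%g by apply: (@mulgI _ g); rewrite mulg1 -gs.
  have := act1 _ 0 s1; have := act1 _ 1 s1.
  by case: (bs_act_gens sS) => ->; lra.
case=> [[<-]|[-> gs]].
  by move=> /mulgI ss'; congr (_, _); apply: val_inj.
have s1 : (s' * s)%g = 1%g.
  by apply: (@mulgI _ g'); rewrite mulgA gs mulg1.
have := act1 _ 0 s1; have := act1 _ 1 s1; rewrite !bs_actM.
case: (bs_act_gens (set_mem sS)) => es; case: (bs_act_gens (set_mem sS')) => es';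
  rewrite !es !es' => h1 h0; clear - h1 h0; exfalso; lra.
Qed.

Lemma bs_cayley_connected : connected_graph (cayley bs_gens).
Proof.
pose E := fun x y : BS12 =>
  exists e : edge (cayley bs_gens), src e = x /\ tgt e = y.
have step (g : BS12) s : bs_gens s -> E g (g * s)%g.
  by move=> sS; exists (g, SigSub (mem_set sS)).
have from1 w (g : BS12) : clos_refl_sym_trans _ E g (g * class_of bs_rels w)%g.
  elim: w g => [|[l b] w IH] g; first by rewrite mulg1; exact: rst_refl.
  have -> : class_of bs_rels ((l, b) :: w)
      = (class_of bs_rels [:: (l, b)] * class_of bs_rels w)%g :> BS12.
    by rewrite [RHS]class_of_cat.
  rewrite mulgA; apply: rst_trans (IH _).
  have gS : bs_gens (gen bs_rels l).
    by case: l {IH}; [left; left | left; right].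
  case: b => /=; first exact/rst_step/step.
  rewrite -[X in clos_refl_sym_trans _ _ X _](mulgVK (gen bs_rels l)).
  have -> : class_of bs_rels [:: (l, false)] = ((gen bs_rels l)^-1)%g :> BS12.
    by rewrite class_of_inv.
  exact/rst_sym/rst_step/step.
move=> u v; rewrite -[v](mulVKg u) -[(u^-1 * v)%g]class_of_repr; exact: from1.
Qed.

Definition BS12_cayley : simplicialGraph :=
  SimplicialGraph bs_cayley_simplicial bs_cayley_connected.

(* Main.v *)
Require Import Defs.
From mathcomp Require Import all_classical all_reals.
From Stdlib Require Import Relations.
From mathcomp Require Import all_boot all_order all_algebra ereal.
From mathcomp Require Import ring lra zify.

Set Implicit Arguments.
Unset Strict Implicit.
Unset Printing Implicit Defensive.

Import Order.TTheory GRing.Theory Num.Theory.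

Local Open Scope classical_set_scope.
Local Open Scope ring_scope.

(** Write an element of BS(1,2) as the affine map it induces on the rationals,
    y |-> 2^k y + x, and call k its height.  In the Cayley graph an a-edge at
    height k moves x by 2^k, while t and tau move the height by 1 and 2.  As
    tau^n a tau^-n = a^(4^n) commutes with a, the word
    tau^n a tau^-n a tau^n a^-1 tau^-n a^-1 spells a closed path of length 2m
    with m = 2n + 2.  The claim is that, for n > 1, it is an isometric cycle;
    as its length is unbounded, no theta can exist.

    Antipodal vertices of this closed path have equal height, and their x
    coordinates differ by 4^n + 1 or 4^n - 1, which is odd and nearly 4^n.  A
    walk joining them must use an a-edge at height at most 0, for otherwise x
    would change by an even integer.  If h is the greatest height of the a-edges
    it uses, then going from the low edge to the high one and back costs at
    least h steps, and p + 1 a-edges of which one contributes at most 1 change x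
    by at most p 2^h + 1; hence p 2^h >= 4^n - 2, and then p + 1 + h >= m
    ([walk_estimate], [mul_exp2_lt], [odd_walk_length]).  This assumes h >= 0;
    for h < 0 the number of a-edges alone is too large.

    It remains to pass from antipodal vertices to the metric of the cell
    complex.  If antipodal vertices of a closed path of length 2m are at
    distance m, so are all antipodal points ([polyline_antipodal]), because a
    curve between two different edges leaves each of them through an endpoint
    ([polyline_opoint_ge]).  A curve between two arbitrary points of the loop
    that is shorter than the arc could be prolonged along the loop to a curve
    of length less than m between antipodal points ([arc_dist_le]).  So the loop
    is isometrically embedded ([antipodal_isometric_cycle]). *)

(** * Oriented edges and walks *)

Section Walks.
Variable G : graph.

(** The boolean tells whether the edge is run through from [src] to [tgt]. *)
Definition oedge := (edge G * bool)%type.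
Definition osrc (e : oedge) := if e.2 then src e.1 else tgt e.1.
Definition otgt (e : oedge) := if e.2 then tgt e.1 else src e.1.

Inductive walk (u : vert G) : vert G -> nat -> Prop :=
| walk_nil : walk u u 0
| walk_snoc e n : walk u (osrc e) n -> walk u (otgt e) n.+1.

Definition adjacent (u v : vert G) :=
  exists2 e : oedge, osrc e = u & otgt e = v.

Lemma adjacent_sym (u v : vert G) : adjacent u v -> adjacent v u.
Proof. by case=> -[e b] <- <-; exists (e, ~~ b); rewrite /osrc /otgt; case: b. Qed.

End Walks.

(** * The combinatorial distance *)

Section GraphDistance.
Variable G : simplicialGraph.
Implicit Types u v : vert G.

Lemma walk_exists u v : exists n, `[< walk u v n >].
Proof.
have := clos_rst_rstn1 _ _ _ _ (sgraph_connected u v).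
elim=> [|w w' ww' _ [n /asboolP un]]; first by exists 0; apply/asboolP/walk_nil.
exists n.+1; apply/asboolP.
by case: ww' un => -[e [<- <-]] un;
  [apply: (@walk_snoc _ _ (e, true)) | apply: (@walk_snoc _ _ (e, false))].
Qed.

Definition gdist u v := ex_minn (walk_exists u v).

Lemma gdist_walk u v : walk u v (gdist u v).
Proof. by rewrite /gdist; case: ex_minnP => n /asboolP. Qed.

Lemma gdist_le u v n : walk u v n -> (gdist u v <= n)%N.
Proof.
by move=> uv; rewrite /gdist; case: ex_minnP => k _; apply; apply/asboolP.
Qed.

Lemma gdistxx u : gdist u u = 0.
Proof. by apply/eqP; rewrite -leqn0; apply/gdist_le/walk_nil. Qed.

Lemma gdist_eq0 u v : gdist u v = 0 -> u = v.
Proof. by move=> d0; have := gdist_walk u v; rewrite d0; inversion 1. Qed.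

Lemma gdist_otgt u (e : oedge G) : (gdist u (otgt e) <= (gdist u (osrc e)).+1)%N.
Proof. exact/gdist_le/walk_snoc/gdist_walk. Qed.

Lemma gdist_osrc u (e : oedge G) : (gdist u (osrc e) <= (gdist u (otgt e)).+1)%N.
Proof.
case: e => e []; first exact: (gdist_otgt u (e, false)).
exact: (gdist_otgt u (e, true)).
Qed.

End GraphDistance.

(** * Points and curves in the cell complex *)

Section Realization.
Variables (R : realType).

Section AnyGraph.
Variable G : graph.
Implicit Types (x y z : Defs.point R G) (e : oedge G) (l s : R).

Definition opoint e s : Defs.point R G :=
  edge_point e.1 (if e.2 then s else 1 - s).

Variant edge_point_spec (e : edge G) s : Defs.point R G -> Prop :=
| EdgeSrc of s = 0 : edge_point_spec e s (Vertex R (src e))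
| EdgeTgt of s = 1 : edge_point_spec e s (Vertex R (tgt e))
| EdgeInt (r : open_unit R) of s = val r : edge_point_spec e s (Interior e r).

Lemma edge_pointP (e : edge G) s :
  0 <= s <= 1 -> edge_point_spec e s (edge_point e s).
Proof.
move=> s01; rewrite /edge_point; case: insubP => [r _ rs|].
  by constructor.
case: (leP s 0) => s0; first by constructor; lra.
by move=> s01'; constructor; lra.
Qed.

Lemma edge_point0 (e : edge G) : edge_point e (0 : R) = Vertex R (src e).
Proof.
have h01 : 0 <= (0 : R) <= 1 by lra.
by case: (edge_pointP e h01) => // [?|[r /= ?] ?]; exfalso; lra.
Qed.

Lemma edge_point1 (e : edge G) : edge_point e (1 : R) = Vertex R (tgt e).
Proof.
have h01 : 0 <= (1 : R) <= 1 by lra.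
by case: (edge_pointP e h01) => // [?|[r /= ?] ?]; exfalso; lra.
Qed.

Lemma opoint0 e : opoint e 0 = Vertex R (osrc e).
Proof.
by case: e => e []; rewrite /opoint /osrc /= ?subr0 ?edge_point0 ?edge_point1.
Qed.

Lemma opoint1 e : opoint e 1 = Vertex R (otgt e).
Proof.
by case: e => e []; rewrite /opoint /otgt /= ?subrr ?edge_point0 ?edge_point1.
Qed.

(** Reversing an edge reparametrizes it by s |-> 1 - s, an isometry of [0,1]. *)
Lemma polyline_opoint e s s' y l : 0 <= s <= 1 -> 0 <= s' <= 1 ->
  polyline (opoint e s') y l -> polyline (opoint e s) y (`|s - s'| + l).
Proof.
case: e => e [] hs hs'; first exact: polyline_cons.
have -> : `|s - s'| = `|(1 - s) - (1 - s')| by rewrite distrC; congr `|_|; ring.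
by apply: polyline_cons; lra.
Qed.

Lemma polyline_trans x y z l l' :
  polyline x y l -> polyline y z l' -> polyline x z (l + l').
Proof.
elim=> {x y l} [x|e s s' y l hs hs' _ IH] yz; first by rewrite add0r.
by rewrite -addrA; apply/polyline_cons/IH.
Qed.

Lemma polyline_sym x y l : polyline x y l -> polyline y x l.
Proof.
elim=> {x y l} [x|e s s' y l hs hs' _ IH]; first exact: polyline_nil.
rewrite addrC; apply: polyline_trans IH _.
rewrite distrC -[X in polyline _ _ X]addr0.
exact/polyline_cons/polyline_nil.
Qed.

(** A function that is 1-Lipschitz on each closed edge cannot vary by more than
    the length of a curve.  All lower bounds on distances come from here. *)
Lemma polyline_lipschitz (F : Defs.point R G -> R) :
  (forall (e : edge G) s s', 0 <= s <= 1 -> 0 <= s' <= 1 ->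
     `|F (edge_point e s) - F (edge_point e s')| <= `|s - s'|) ->
  forall x y l, polyline x y l -> `|F x - F y| <= l.
Proof.
move=> FL x y l; elim=> {x y l} [x|e s s' y l hs hs' _ IH].
  by rewrite subrr normr0.
apply: le_trans (ler_distD (F (edge_point e s')) _ _) _.
by rewrite lerD ?FL.
Qed.

Lemma dist_polyline x y l : polyline x y l ->
  (forall l', polyline x y l' -> l <= l') -> dist x y = l%:E.
Proof.
move=> xyl lmin; apply/eqP; rewrite eq_le; apply/andP; split.
  by apply: ereal_inf_lbound; exists l.
by apply: le_ereal_inf_tmp => _ [l' /= /lmin ll' <-]; rewrite lee_fin.
Qed.

(** An infinite edge path gives a curve parametrized by arc length on the
    nonnegative reals. *)
Variable E : nat -> oedge G.
Hypothesis EE : forall i, otgt (E i) = osrc (E i.+1).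

Definition loop_point (s : R) :=
  opoint (E (Num.truncn s)) (s - (Num.truncn s)%:R).

(** The value s = 1 is included: the end of an edge is the start of the next. *)
Lemma loop_pointD i s : 0 <= s <= 1 -> loop_point (i%:R + s) = opoint (E i) s.
Proof.
move=> /andP[s0]; rewrite le_eqVlt => /orP[/eqP ->|s1].
  have -> : i%:R + 1 = i.+1%:R + 0 :> R by rewrite -natr1 addr0.
  by rewrite /loop_point addr0 natrK subrr opoint0 opoint1 EE.
have -> : i%:R + s = s + i%:R by rewrite addrC.
rewrite /loop_point (_ : Num.truncn (s + i%:R) = i) ?addrK //.
by apply: truncn_def; rewrite -natr1; lra.
Qed.

(** The curve is cut at the integers that it crosses. *)
Lemma polyline_loop s s' : 0 <= s <= s' ->
  polyline (loop_point s) (loop_point s') (s' - s).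
Proof.
have seg i (r r' : R) : 0 <= r <= r' -> r' <= 1 ->
    polyline (loop_point (i%:R + r)) (loop_point (i%:R + r')) (r' - r).
  move=> hr hr'; rewrite !loop_pointD; try lra.
  have -> : r' - r = `|r - r'| + 0 by rewrite addr0 ler0_norm; lra.
  by apply: polyline_opoint; [lra..|exact: polyline_nil].
have frac (r : R) : 0 <= r -> 0 <= r - (Num.truncn r)%:R < 1.
  by move=> /truncn_itv; rewrite -natr1; lra.
have up i j : polyline (loop_point i%:R) (loop_point (i + j)%:R) j%:R.
  elim: j => [|j IH]; first by rewrite addn0; exact: polyline_nil.
  rewrite -natr1; apply: polyline_trans IH _.
  have := seg (i + j)%N 0 1; rewrite addr0 subr0 natr1 -addnS; apply; lra.
move=> /andP[s0 ss']; have s'0 := le_trans s0 ss'.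
have := frac s s0; have := frac s' s'0.
set i := Num.truncn s; set i' := Num.truncn s' => fs' fs.
have ii' : (i <= i')%N by exact: le_truncn.
have sE : s = i%:R + (s - i%:R) by lra.
have s'E : s' = i'%:R + (s' - i'%:R) by lra.
move: ii'; rewrite leq_eqVlt => /orP[/eqP ii'|ii'].
  rewrite sE s'E -ii'; have := seg i (s - i%:R) (s' - i%:R).
  have -> : s' - i%:R - (s - i%:R) = i%:R + (s' - i%:R) - (i%:R + (s - i%:R)) by ring.
  by apply; rewrite ?ii'; move: fs'; rewrite -ii'; lra.
have -> : s' - s = (1 - (s - i%:R)) + ((i' - i.+1)%:R + (s' - i'%:R - 0)).
  by rewrite natrB // -natr1; ring.
apply: (@polyline_trans _ (loop_point i.+1%:R)).
  by have := seg i (s - i%:R) 1; rewrite -sE natr1; apply; lra.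
apply: (@polyline_trans _ (loop_point i'%:R)).
  by have := up i.+1 (i' - i.+1)%N; rewrite subnKC.
by have := seg i' 0 (s' - i'%:R); rewrite addr0 -s'E; apply; lra.
Qed.

End AnyGraph.

(** * Distance between points of different edges *)

Section LowerBound.
Variable G : simplicialGraph.

(** A curve from a point of [e0] to a point of another edge passes through an
    endpoint of each, which gives four candidates for its length.  Instead of
    cutting the curve, the proof exhibits the 1-Lipschitz function F that a
    posteriori is the distance to [opoint e0 r]: it is |u - r| on [e0], and on
    the other edges it is the smaller of the values reached through the two
    endpoints. *)
Lemma polyline_opoint_ge (e0 e : oedge G) (r s b l : R) :
  e0.1 <> e.1 -> 0 <= r <= 1 -> 0 <= s <= 1 ->
  b <= r + (gdist (osrc e0) (osrc e))%:R + s ->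
  b <= r + (gdist (osrc e0) (otgt e))%:R + (1 - s) ->
  b <= (1 - r) + (gdist (otgt e0) (osrc e))%:R + s ->
  b <= (1 - r) + (gdist (otgt e0) (otgt e))%:R + (1 - s) ->
  polyline (opoint e0 r) (opoint e s) l -> b <= l.
Proof.
move=> ee0 r01 s01 b1 b2 b3 b4.
pose phi (v : vert G) : R :=
  Num.min (r + (gdist (osrc e0) v)%:R) (1 - r + (gdist (otgt e0) v)%:R).
pose F (x : Defs.point R G) := match x with
  | Vertex v => phi v
  | Interior f u =>
      if `[< f = e0.1 >] then `|(if e0.2 then val u else 1 - val u) - r|
      else Num.min (phi (src f) + val u) (phi (tgt f) + (1 - val u))
  end.
have phi_step (f : oedge G) : phi (osrc f) <= phi (otgt f) + 1.
  rewrite /phi -lerBlDr le_min !lerBlDr !ge_min -!addrA !lerD2l !natr1 !ler_nat.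
  by rewrite !gdist_osrc orbT.
(* The two next facts make F continuous at the endpoints of e0. *)
have phi_src : phi (osrc e0) = r.
  rewrite /phi gdistxx addr0 min_l //.
  have : 0 <= (gdist (otgt e0) (osrc e0))%:R :> R by [].
  suff : 1 <= (gdist (otgt e0) (osrc e0))%:R :> R by lra.
  rewrite ler1n lt0n; apply/eqP => /gdist_eq0.
  have [loopless _] := sgraph_simplicial G.
  by have := loopless e0.1; rewrite /osrc /otgt; case: e0.2 => // + /esym.
have phi_tgt : phi (otgt e0) = 1 - r.
  rewrite /phi gdistxx addr0 min_r //.
  suff : 1 <= (gdist (osrc e0) (otgt e0))%:R :> R by lra.
  rewrite ler1n lt0n; apply/eqP => /gdist_eq0.
  have [loopless _] := sgraph_simplicial G.
  by have := loopless e0.1; rewrite /osrc /otgt; case: e0.2 => // + /esym.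
have Fe0 u : 0 <= u <= 1 -> F (opoint e0 u) = `|u - r|.
  move=> u01; rewrite /opoint; move: phi_src phi_tgt.
  rewrite /F /osrc /otgt; case: e0.2 => /= p0 p1.
    case: (edge_pointP e0.1 u01) => [||v] //= uE.
    + by rewrite p0 uE sub0r normrN ger0_norm //; lra.
    + by rewrite p1 uE ger0_norm //; lra.
    + by rewrite asboolT // uE.
  have u01' : 0 <= 1 - u <= 1 by lra.
  case: (edge_pointP e0.1 u01') => [||v] /= uE.
  + by rewrite p1 ger0_norm; lra.
  + by rewrite p0 ler0_norm; lra.
  + by rewrite asboolT //; congr `|_|; lra.
have Fe (f : edge G) u : f <> e0.1 -> 0 <= u <= 1 ->
    F (edge_point f u) = Num.min (phi (src f) + u) (phi (tgt f) + (1 - u)).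
  move=> fe0 u01.
  have := phi_step (f, true); have := phi_step (f, false).
  rewrite /F /osrc /otgt /= => st ts.
  case: (edge_pointP f u01) => [->|->|v ->].
  - by rewrite addr0 subr0 min_l.
  - by rewrite subrr addr0 min_r.
  - by rewrite asboolF.
have FL (f : edge G) u v : 0 <= u <= 1 -> 0 <= v <= 1 ->
    `|F (edge_point f u) - F (edge_point f v)| <= `|u - v|.
  move=> u01 v01; have [->|fe0] := pselect (f = e0.1).
    have eo w : edge_point e0.1 w = opoint e0 (if e0.2 then w else 1 - w).
      by rewrite /opoint; case: e0.2 => //; rewrite opprB addrCA subrr addr0.
    rewrite !eo !Fe0; [|by case: e0.2; lra..].
    apply: le_trans (ler_dist_dist _ _) _.
    rewrite le_eqVlt; apply/orP; left; apply/eqP.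
    by case: e0.2; [|rewrite distrC]; congr `|_|; ring.
  rewrite !Fe // ler_distl.
  have [] : u - v <= `|u - v| /\ v - u <= `|u - v|.
    by split; last rewrite distrC; exact: ler_norm.
  move: `|u - v| (phi (src f)) (phi (tgt f)) => d p q du dv.
  rewrite !lerBlDr -!lerBlDr !le_min !lerBlDr !ge_min.
  apply/andP; split; apply/andP; split; apply/orP; [left|right|left|right]; lra.
move=> /(polyline_lipschitz FL); rewrite Fe0 // subrr normr0 sub0r normrN.
apply: le_trans; apply: le_trans (ler_norm _).
have s01' : 0 <= 1 - s <= 1 by lra.
have -> : F (opoint e s) = Num.min (phi (osrc e) + s) (phi (otgt e) + (1 - s)).
  rewrite /opoint /osrc /otgt; case: e.2 => /=; rewrite Fe //; try exact: nesym.
  by rewrite minC subKr.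
rewrite /phi !le_min -!lerBlDr !le_min !lerBlDr.
by rewrite b1 b2 b3 b4.
Qed.

End LowerBound.

(** * Closed edge paths *)

Section PeriodicLoop.
Variables (G : graph) (N : nat) (E : nat -> oedge G).
Hypothesis EE : forall i, otgt (E i) = osrc (E i.+1).
Hypothesis E_periodic : forall i, E (i + N)%N = E i.

(** The distance on a circle of length N between the points of coordinates s
    and s'. *)
Definition arc_dist (s s' : R) := Num.min `|s - s'| (N%:R - `|s - s'|).

Lemma loop_point_periodic s : 0 <= s -> loop_point E (s + N%:R) = loop_point E s.
Proof.
move=> s0; rewrite /loop_point.
have -> : Num.truncn (s + N%:R) = (Num.truncn s + N)%N.
  by apply: truncn_def; rewrite -addSn !natrD lerD2r ltrD2r truncn_itv.
by rewrite E_periodic natrD; congr opoint; ring.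
Qed.

(** The shorter of the two arcs runs from s to s', or from s' to s + N. *)
Lemma polyline_arc s s' : 0 <= s < N%:R -> 0 <= s' < N%:R ->
  polyline (loop_point E s) (loop_point E s') (arc_dist s s').
Proof.
wlog ss' : s s' / s <= s'.
  move=> H hs hs'; case/orP: (le_total s s') => ss'; first exact: H.
  by rewrite /arc_dist distrC; apply/polyline_sym/H.
move=> hs hs'; rewrite /arc_dist distrC ger0_norm ?subr_ge0 // minEle.
case: ifP => _; first by apply: polyline_loop => //; lra.
apply: polyline_sym; rewrite -[loop_point E s]loop_point_periodic; last lra.
have -> : N%:R - (s' - s) = s + N%:R - s' by ring.
by apply: polyline_loop => //; lra.
Qed.

End PeriodicLoop.

(** * The cycle with N edges *)

Section CycleGraph.
Variable N : nat.
Hypothesis N_gt0 : (0 < N)%N.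

Definition cycle_graph : graph := Graph (fun i : 'I_N => i) (@ordS N).

(** The arc length coordinate; its inverse is [loop_point] for the edge path
    that runs around the cycle. *)
Definition position (x : Defs.point R cycle_graph) : R :=
  match x with
  | Vertex i => (i : 'I_N)%:R
  | Interior i u => (i : 'I_N)%:R + val u
  end.

Definition cycle_edge (i : nat) : oedge cycle_graph :=
  (Ordinal (ltn_pmod i N_gt0), true).

Lemma cycle_edge_ord (i : 'I_N) : cycle_edge i = (i, true).
Proof. by congr (_, _); apply: val_inj; rewrite /= modn_small. Qed.

Lemma cycle_edge_chain i : otgt (cycle_edge i) = osrc (cycle_edge i.+1).
Proof. by apply: val_inj; rewrite /= -addn1 modnDml addn1. Qed.

Lemma cycle_edge_periodic i : cycle_edge (i + N) = cycle_edge i.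
Proof. by congr (_, _); apply: val_inj; rewrite /= modnDr. Qed.

Lemma position_bounds x : 0 <= position x < N%:R.
Proof.
case: x => [i|i [u u01]] /=; first by rewrite ler0n ltr_nat ltn_ord.
have : (i : 'I_N).+1%:R <= N%:R :> R by rewrite ler_nat ltn_ord.
have : 0 <= (i : 'I_N)%:R :> R by [].
by move: u01; rewrite -natr1; lra.
Qed.

Lemma loop_position x : loop_point cycle_edge (position x) = x.
Proof.
case: x => [i|i u] /=.
  rewrite -[_%:R]addr0 loop_pointD ?lexx ?ler01 //; last exact: cycle_edge_chain.
  by rewrite cycle_edge_ord opoint0.
rewrite loop_pointD ?cycle_edge_ord; first last.
- by case: u => u /= u01; lra.
- exact: cycle_edge_chain.
by rewrite /opoint /= /edge_point valK.
Qed.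

Lemma position_loop s : 0 <= s < N%:R -> position (loop_point cycle_edge s) = s.
Proof.
move=> sN; have s0 : 0 <= s by lra.
have := truncn_itv s0; rewrite -natr1 => hi.
have iN : (Num.truncn s < N)%N by rewrite truncn_lt_nat //; lra.
rewrite /loop_point (cycle_edge_ord (Ordinal iN)) /opoint /=.
have u01 : 0 <= s - (Num.truncn s)%:R <= 1 by lra.
case: (edge_pointP (Ordinal iN : edge cycle_graph) u01) => [| |u] /= us; lra.
Qed.

End CycleGraph.

(** * Closed paths with distant antipodes are isometric *)

Section AntipodalCycle.
Variables (G : simplicialGraph) (m : nat) (E : nat -> oedge G).
Hypothesis m_gt1 : (1 < m)%N.
Hypothesis EE : forall i, otgt (E i) = osrc (E i.+1).
Hypothesis E_periodic : forall i, E (i + m.*2)%N = E i.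
Hypothesis E_antipodal :
  forall i k, walk (osrc (E i)) (osrc (E (i + m))) k -> (m <= k)%N.

(** Between the edges E i and E (i + m), endpoints of the same index are at
    distance at least m, and the two crossed pairs at distance at least m - 1.
    For the points at offset r on both, the four candidates are then at least
    m + 2r, m, m and m + 2(1 - r). *)
Lemma polyline_antipodal s l : 0 <= s ->
  polyline (loop_point E s) (loop_point E (s + m%:R)) l -> m%:R <= l.
Proof.
move=> s0; have := truncn_itv s0; rewrite -natr1.
set i := Num.truncn s => hi.
have hr : 0 <= s - i%:R <= 1 by lra.
have far j : (m <= gdist (osrc (E j)) (osrc (E (j + m))))%N.
  exact/E_antipodal/gdist_walk.
have d00 := far i; have d11 := far i.+1; rewrite addSn -!EE in d11.
have d01 := gdist_osrc (osrc (E i)) (E (i + m)).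
have d10 := gdist_otgt (otgt (E i)) (E (i + m)).
have -> : loop_point E s = opoint (E i) (s - i%:R) by [].
have -> : s + m%:R = (i + m)%:R + (s - i%:R) by rewrite natrD; ring.
rewrite loop_pointD //.
have pred : m.-1%:R = m%:R - 1 :> R by rewrite -subn1 natrB //; lia.
have le_pred k : (m.-1 <= k)%N -> m%:R - 1 <= k%:R :> R by rewrite -pred ler_nat.
have {}le_m k : (m <= k)%N -> m%:R <= k%:R :> R by rewrite ler_nat.
apply: polyline_opoint_ge => //.
(* Equal edges would identify c i with c (i + m) or with c (i + m + 1), where
   c i is the start of E i; their distances from c i are at least m - 1 > 0. *)
- move=> e_eq; have : osrc (E i) = osrc (E (i + m)) \/ osrc (E i) = otgt (E (i + m)).
    by rewrite /osrc /otgt e_eq; case: (E i).2; case: (E _).2; [left|right|right|left].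
  case=> v_eq; first by move: d00; rewrite -v_eq gdistxx; lia.
  by move: d01 d00; rewrite -v_eq gdistxx; lia.
- by have := le_m _ d00; lra.
- have : (m.-1 <= gdist (osrc (E i)) (otgt (E (i + m))))%N by lia.
  by move=> /le_pred; lra.
- have : (m.-1 <= gdist (otgt (E i)) (osrc (E (i + m))))%N by lia.
  by move=> /le_pred; lra.
- by have := le_m _ d11; lra.
Qed.

Let N := m.*2.

(** A curve from s to s' is continued along the loop to the antipode s + m: the
    total length is at least m, and the added part is |s + m - s'|. *)
Lemma arc_dist_le s s' l : 0 <= s < N%:R -> 0 <= s' < N%:R ->
  polyline (loop_point E s) (loop_point E s') l -> arc_dist N s s' <= l.
Proof.
wlog ss' : s s' / s <= s'.
  move=> H hs hs'; case/orP: (le_total s s') => ss'; first exact: H.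
  by rewrite /arc_dist distrC => /polyline_sym; exact: H.
move=> hs hs' pl; rewrite /arc_dist distrC ger0_norm ?subr_ge0 //.
have NE : N%:R = m%:R + m%:R :> R by rewrite -natrD addnn.
rewrite ge_min NE; apply/orP; case: (leP s' (s + m%:R)) => h.
  left; have /(polyline_trans pl)/polyline_antipodal :
     polyline (loop_point E s') (loop_point E (s + m%:R)) (s + m%:R - s').
    by apply: polyline_loop => //; lra.
  lra.
right; have /polyline_sym/(polyline_trans pl)/polyline_antipodal :
     polyline (loop_point E (s + m%:R)) (loop_point E s') (s' - (s + m%:R)).
  by apply: polyline_loop => //; have : 0 <= m%:R :> R by []; lra.
lra.
Qed.

Let N_gt0 : (0 < N)%N. Proof. by rewrite /N; lia. Qed.

(** The cycle wrapped around the closed path E by arc length. *)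
Definition around (x : Defs.point R (cycle_graph N)) : Defs.point R G :=
  loop_point E (position x).

Lemma around_edge (i : 'I_N) s : 0 <= s <= 1 ->
  around (edge_point (i : edge (cycle_graph N)) s) = opoint (E i) s.
Proof.
move=> s01; rewrite /around.
case: (edge_pointP (i : edge (cycle_graph N)) s01) => [->|->|u ->].
- by rewrite /= -[i%:R]addr0 loop_pointD ?lexx ?ler01.
- rewrite opoint1 EE -opoint0 -loop_pointD ?lexx ?ler01 // addr0.
  have [iN|iN] := ltnP i.+1 N; first by rewrite /= modn_small.
  have -> : i.+1 = (0 + N)%N by have := ltn_ord i; lia.
  rewrite natrD loop_point_periodic //=.
  have -> : i.+1 = N by have := ltn_ord i; lia.
  by rewrite modnn.
- by rewrite loop_pointD //; case: u => u /= u01; lra.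
Qed.

Lemma polyline_around x y l : polyline x y l -> polyline (around x) (around y) l.
Proof.
elim=> {x y l} [x|i s s' y l hs hs' _ IH]; first exact: polyline_nil.
by rewrite around_edge //; apply: polyline_opoint => //; rewrite -around_edge.
Qed.

(** The metric of the abstract cycle also needs a lower bound; it is pulled back
    from G, since [around] preserves the length of curves. *)
Lemma dist_cycle (x y : Defs.point R (cycle_graph N)) :
  dist x y = (arc_dist N (position x) (position y))%:E.
Proof.
apply: dist_polyline.
  rewrite -{1}(loop_position N_gt0 x) -{1}(loop_position N_gt0 y).
  apply: polyline_arc; try exact: position_bounds.
    exact: cycle_edge_chain.
  exact: cycle_edge_periodic.
by move=> l /polyline_around; apply: arc_dist_le; exact: position_bounds.
Qed.

Lemma around_isometric : isometric around.
Proof.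
move=> x y; rewrite dist_cycle; apply: dist_polyline.
  by apply: polyline_arc => //; exact: position_bounds.
by move=> l; apply: arc_dist_le; exact: position_bounds.
Qed.

Lemma around_cycle_in : cycle_in around.
Proof.
split=> [x eps eps0|i|i].
- by exists eps => // y; rewrite around_isometric.
- exists (osrc (E (i : 'I_N))).
  by rewrite -edge_point0 around_edge ?lexx ?ler01 // opoint0.
exists (E (i : 'I_N)).1; apply/seteqP; split=> [_ [_ [s s01 <-] <-]|_ [s s01 <-]].
  rewrite around_edge //; exists (if (E (i : 'I_N)).2 then s else 1 - s) => //=.
  by move: s01 => /=; case: (E _).2; lra.
have s01' : 0 <= (if (E (i : 'I_N)).2 then s else 1 - s) <= 1.
  by move: s01 => /=; case: (E _).2; lra.
exists (edge_point (i : edge (cycle_graph N)) (if (E (i : 'I_N)).2 then s else 1 - s)).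
  by eexists; [exact: s01'|].
rewrite around_edge // /opoint; case: (E _).2 => //.
by congr edge_point; ring.
Qed.

Lemma cycle_graph_is_cycle : is_cycle R (cycle_graph N).
Proof.
have N0 : 0 < N%:R :> R by rewrite ltr0n.
have F01 (x : Defs.point R (cycle_graph N)) : 0 <= position x / N%:R < 1.
  by rewrite divr_ge0 ?ltr_pdivrMr ?mul1r //; case/andP: (position_bounds x).
have FK (p : circle R) : 0 <= val p * N%:R < N%:R.
  by have /andP[p0 p1] := valP p; rewrite mulr_ge0 // -ltr_pdivlMr // divff // gt_eqF.
pose F (x : Defs.point R (cycle_graph N)) : circle R :=
  exist (fun s : R => is_true (0 <= s < 1)) _ (F01 x).
pose H (p : circle R) : Defs.point R (cycle_graph N) := loop_point (cycle_edge N_gt0) (val p * N%:R).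
have N_neq0 : N%:R != 0 :> R by rewrite gt_eqF.
have HF : cancel F H.
  by move=> x; rewrite /H /= divfK // loop_position.
have FH : cancel H F.
  by move=> p; apply: val_inj; rewrite /= position_loop // mulfK.
have distF x y : dist x y = (N%:R%:E * circle_dist (F x) (F y))%E.
  rewrite dist_cycle /circle_dist /= -EFinM; congr (_%:E).
  rewrite -mulrBl normrM [`|N%:R^-1|]ger0_norm ?invr_ge0 // /arc_dist.
  by rewrite minr_pMr // mulrBr mulr1 mulrCA divff // mulr1.
exists F, H; split=> //.
- move=> x eps eps0; exists (N%:R * eps); first by rewrite mulr_gt0.
  by move=> y; rewrite distF EFinM lte_pmul2l.
move=> p eps eps0; exists (eps / N%:R); first by rewrite divr_gt0.
move=> q; rewrite distF !FH => pq.
have -> : eps = N%:R * (eps / N%:R) by rewrite mulrC divfK.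
by rewrite EFinM lte_pmul2l.
Qed.

End AntipodalCycle.
End Realization.

(** The choice of the edges is made on indices below 2m and extended
    periodically, so that the edge path is closed as well as the vertex path. *)
Lemma antipodal_isometric_cycle (R : realType) (G : simplicialGraph) (m : nat)
    (c : nat -> vert G) :
  (1 < m)%N -> (forall i, c (i + m.*2)%N = c i) ->
  (forall i, adjacent (c i) (c i.+1)) ->
  (forall i k, walk (c i) (c (i + m)%N) k -> (m <= k)%N) ->
  exists f : Defs.point R (cycle_graph m.*2) -> Defs.point R G,
    [/\ is_cycle R (cycle_graph m.*2), cycle_in f & isometric f].
Proof.
move=> m1 per adj far.
have adj' i : exists e : oedge G, osrc e = c i /\ otgt e = c i.+1.
  by have [e] := adj i; exists e.
have [E0 E0P] := choice adj'.
pose E i := E0 (i %% m.*2)%N.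
have c_mod i : c (i %% m.*2)%N = c i.
  rewrite [in RHS](divn_eq i m.*2) addnC.
  by elim: (i %/ m.*2)%N => [|q IH]; rewrite ?addn0 // mulSnr addnA per.
have srcE i : osrc (E i) = c i by rewrite (E0P _).1 c_mod.
have EE i : otgt (E i) = osrc (E i.+1).
  by rewrite srcE (E0P _).2 -c_mod -addn1 modnDml addn1 c_mod.
have E_per i : E (i + m.*2)%N = E i by rewrite /E modnDr.
have E_far i k : walk (osrc (E i)) (osrc (E (i + m)%N)) k -> (m <= k)%N.
  by rewrite !srcE; exact: far.
exists (around E); split.
- exact: (cycle_graph_is_cycle R m1 EE E_per E_far).
- exact: (around_cycle_in R m1 EE E_per E_far).
- exact (around_isometric m1 EE E_per E_far).
Qed.

(** * Lengths of walks in the Cayley graph *)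

(** In Z[1/2] x| Z, the element g is (x, k); t acts on Z[1/2] by doubling. *)
Definition affine (g : BS12) (x : rat) (k : int) :=
  forall y, bs_act g y = 2 ^ k * y + x.

Lemma affine_inj g x k x' k' : affine g x k -> affine g x' k' -> x = x' /\ k = k'.
Proof.
move=> gx gx'; have xx' : x = x'.
  by have := gx 0; rewrite gx' !mulr0 !add0r.
split=> //; have := gx 1; rewrite gx' xx' !mulr1 => /addIr/esym.
by apply: ieexprIz.
Qed.

Lemma affine_a (g : BS12) x k : affine g x k -> affine (g * bs_a)%g (x + 2 ^ k) k.
Proof. by move=> gx y; rewrite bs_actM gx bs_act_class /=; ring. Qed.

Lemma affine_t (g : BS12) x k : affine g x k -> affine (g * bs_t)%g x (k + 1).
Proof.
by move=> gx y; rewrite bs_actM gx bs_act_class /= expfzDr // expr1z; ring.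
Qed.

Lemma affine_aV (g : BS12) x k : affine (g * bs_a)%g x k -> affine g (x - 2 ^ k) k.
Proof.
move=> gx y; have := gx (y - 1); rewrite bs_actM bs_act_class /= subrK => ->; ring.
Qed.

Lemma affine_tV (g : BS12) x k : affine (g * bs_t)%g x k -> affine g x (k - 1).
Proof.
move=> gx y; have := gx (y / 2); rewrite bs_actM bs_act_class /=.
have -> : 2 * (y / 2) = y by field.
by move=> ->; rewrite expfzDr // exprN1; field.
Qed.

Lemma affine_step (e : oedge (cayley bs_gens)) x k : affine (osrc e) x k ->
  (exists2 j : int, `|j| <= 2 & affine (otgt e) x (k + j)) \/
  (exists2 d, d = 2 ^ k \/ d = - 2 ^ k & affine (otgt e) (x + d) k).
Proof.
have tauE (g : BS12) : (g * bs_tau = g * bs_t * bs_t)%g by rewrite mulgA.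
case: e => [[g [s sP]] []]; rewrite /osrc /otgt /= => gx;
  have /= := set_mem sP; case=> [[sE|sE]|sE]; rewrite sE in gx *.
- by right; exists (2 ^ k); [left|exact: affine_a].
- by left; exists 1 => //; exact: affine_t.
- by left; exists (1 + 1) => //; rewrite tauE addrA; do 2!apply: affine_t.
- by right; exists (- 2 ^ k); [right|exact: affine_aV].
- by left; exists (- 1) => //; exact: affine_tV.
- left; exists (- 1 - 1) => //; rewrite addrA.
  by do 2!apply: affine_tV; rewrite -tauE.
Qed.

(** Total variation of the height of a shortest trip from k to k' that visits
    both l and h: either l or h is visited first. *)
Definition travel (k k' l h : int) : int :=
  Num.min (`|k - l| + (h - l) + `|k' - h|) (`|k - h| + (h - l) + `|k' - l|).

(** Here l and h are the lowest and greatest heights of the a-edges of the walk,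
    and p + 1 is their number, the first alternative being a walk without
    a-edges.  Singling out one edge at height l in the bound on |x' - x| is
    essential: the cruder (p + 1) 2^h would lose one unit of length below.
    Vertical steps have size at most 2, so their number is at least half of the
    variation of the height; the last inequality is multiplied by 2. *)
Lemma walk_estimate (u v : vert (cayley bs_gens)) n x k :
  walk u v n -> affine u x k ->
  exists x' k', affine v x' k' /\
    ((x' = x /\ `|k' - k| <= 2 * n%:Z) \/
     exists (l h : int) (p : nat) (z : int),
       [/\ l <= h, x' - x = z%:~R * 2 ^ l, `|x' - x| <= p%:R * 2 ^ h + 2 ^ l
         & travel k k' l h + 2 * p.+1%:Z <= 2 * n%:Z]).
Proof.
move=> uv ux; elim: uv => {v n} [|e n _ [x' [k' [vx IH]]]].
  by exists x, k; split=> //; left; rewrite subrr normr0.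
have [[j j2 vx']|[d dE vx']] := affine_step vx.
  exists x', (k' + j); split=> //; case: IH => [[-> kk']|[l [h [p [z [lh xz xp lp]]]]]].
    by left; split=> //; lia.
  right; exists l, h, p, z; split=> //; move: lp; rewrite /travel.
  by clear - lh j2; lia.
exists (x' + d), k'; split=> //; right.
(* From here on the last edge is an a-edge, at height k'. *)
have d_norm : `|d| = 2 ^ k' by case: dE => ->; rewrite ?normrN ger0_norm ?exprz_ge0.
case: IH => [[-> kk']|[l [h [p [z [lh xz xp lp]]]]]].
  exists k', k', 0%N, (if d == 2 ^ k' then 1 else - 1); rewrite addrC addKr; split=> //.
  - case: eqP => [->|dN]; first by rewrite mul1r.
    by case: dE => // ->; rewrite mulN1r.
  - by rewrite d_norm mul0r add0r.
  - by rewrite /travel; clear - kk'; lia.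
have pow_le (i i' : int) : i <= i' -> 2 ^ i <= 2 ^ i' :> rat.
  by move=> ii'; apply: ler_weXz2l.
have pow_mul (i i' : int) : i <= i' -> exists y : int, 2 ^ i' = y%:~R * 2 ^ i :> rat.
  move=> ii'; exists (2 ^ `|i' - i|%N).
  rewrite rmorphXn /= exprnP -expfzDr //; congr (_ ^ _); lia.
have tri : `|x' + d - x| <= p%:R * 2 ^ h + 2 ^ l + 2 ^ k'.
  by rewrite addrAC -d_norm (le_trans (ler_normD _ _)) ?lerD2r.
have p0 : 0 <= p%:R :> rat by [].
exists (Num.min l k'), (Num.max h k'), p.+1.
have [y dy] : exists y : int, d = y%:~R * 2 ^ (Num.min l k').
  have [y ky] := pow_mul (Num.min l k') k' ltac:(lia).
  by case: dE => ->; [exists y|exists (- y); rewrite rmorphN mulNr ky].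
have [y' ly'] := pow_mul (Num.min l k') l ltac:(lia).
exists (z * y' + y); split.
- by lia.
- by rewrite addrAC xz {1}ly' dy rmorphD rmorphM /=; ring.
- apply: le_trans tri _.
  have hH := pow_le h (Num.max h k') ltac:(lia).
  have := ler_wpM2l p0 hH; rewrite -[p.+1]addn1 natrD mulrDl mul1r.
  case: (leP l k') => lk.
    by have := pow_le k' (Num.max h k') ltac:(lia); lra.
  by have := pow_le l (Num.max h k') ltac:(lia); lra.
- by move: lp; rewrite /travel; clear - lh; lia.
Qed.

(** With q + h = 2n, this says that p 2^h >= 4^n - 2 forces p > q.  It fails for
    q = 2 and h = 0, whence n > 1 below. *)
Lemma mul_exp2_lt h q : (2 < q + h)%N -> (q * 2 ^ h + 2 < 2 ^ (q + h))%N.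
Proof.
elim: h q => [|h IH] q.
  rewrite addn0 muln1; elim: q => // q IH; rewrite ltnS leq_eqVlt.
  by case/orP=> [/eqP <-//|/IH]; rewrite expnS; lia.
rewrite addnS ltnS leq_eqVlt => /orP[/eqP qh|/IH]; last by rewrite !expnS; lia.
have : (h <= 2)%N by lia.
by case: h qh {IH} => [|[|[|h]]] // qh _; move: qh; case: q => [|[|[|q]]].
Qed.

(** Since the walk returns to its height, the travel is at least 2 (h - l). *)
Lemma odd_walk_length (u v : vert (cayley bs_gens)) n L x x' k (w : int) :
  (1 < n)%N ->
  affine u x k -> affine v x' k -> x' - x = (2 * w + 1)%:~R ->
  4 ^+ n - 1 <= `|x' - x| -> walk u v L -> (2 * n + 2 <= L)%N.
Proof.
move=> n1 ux vx xw xn uv.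
have [x2 [k2 [vx2 est]]] := walk_estimate uv ux.
have {vx2} [? ?] := affine_inj vx vx2; subst x2 k2.
case: est => [[x'x _]|[l [h [p [z [lh xz xp lp]]]]]].
  move: xw; rewrite x'x subrr => /esym/eqP; rewrite intr_eq0; lia.
(* Otherwise x' - x would be an even integer. *)
have l0 : l <= 0.
  rewrite leNgt; apply/negP => l0.
  case: l l0 xz {lh xp lp} => [[|l]|] // _; rewrite xw -exprnP.
  have -> : (2 : rat) = (2 : int)%:~R by [].
  by rewrite exprS -rmorphXn -!rmorphM => /eqP; rewrite eqr_int; lia.
have l1 : 2 ^ l <= 1 :> rat by rewrite -(expr0z 2); apply: ler_weXz2l.
have big : 4 ^+ n - 2 <= p%:R * 2 ^ h :> rat by lra.
have cost : p%:Z + 1 + (h - l) <= L%:Z by move: lp; rewrite /travel; lia.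
(* For h < 0 the a-edges alone are too many. *)
case: h lh xp lp big cost => h lh xp lp big cost; last first.
  have h1 : 2 ^ Negz h <= 1 :> rat by rewrite -(expr0z 2); apply: ler_weXz2l.
  have : 4 ^+ n - 2 <= p%:R :> rat.
    by apply: le_trans big _; rewrite ler_piMr.
  have n4 : (2 * n + 2 < 4 ^ n)%N.
    by have := @mul_exp2_lt 0 (2 * n) ltac:(lia); rewrite addn0 muln1 expnM.
  rewrite lerBlDr -natrX -natrD ler_nat; lia.
have {big} : (2 ^ (2 * n) <= p * 2 ^ h + 2)%N.
  by rewrite -(ler_nat rat) natrD natrM !natrX exprM -lerBlDr.
rewrite leqNgt => /negP big; rewrite leqNgt; apply/negP => Ln; apply: big.
have ph : (p + h < 2 * n + 1)%N by lia.
have := @mul_exp2_lt h (2 * n - h) ltac:(lia).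
rewrite subnK; last by lia.
apply: leq_ltn_trans; rewrite leq_add2r leq_mul2r; apply/orP; right; lia.
Qed.

(** * The commutator of a and its conjugate by a power of tau *)

(** Iterate t a = a^2 t. *)
Lemma bs_tau_a n : (bs_tau ^+ n * bs_a = bs_a ^+ (4 ^ n) * bs_tau ^+ n)%g.
Proof.
have ta : (bs_t * bs_a = bs_a ^+ 2 * bs_t)%g.
  have rel : (bs_t * bs_a * bs_t^-1 = bs_a ^+ 2)%g.
    have -> : (bs_t^-1)%g = class_of bs_rels [:: (letter_t, false)] :> BS12.
      by rewrite [LHS]class_of_inv.
    have aa : (bs_a ^+ 2 = class_of bs_rels [:: (letter_a, true); (letter_a, true)])%g.
      by rewrite expg2 [LHS]class_of_cat.
    rewrite aa [X in (X * _)%g]class_of_cat [LHS]class_of_cat.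
    by apply/class_ofP/word_eq_rel.
  by rewrite -rel mulgVK.
have tak k : (bs_t * bs_a ^+ k = bs_a ^+ (2 * k) * bs_t)%g.
  elim: k => [|k IH]; first by rewrite muln0 !expg0 mulg1 mul1g.
  by rewrite expgSr mulgA IH -mulgA ta mulgA -expgnDr mulnS addnC.
have tauak k : (bs_tau * bs_a ^+ k = bs_a ^+ (4 * k) * bs_tau)%g.
  rewrite /bs_tau expg2 -mulgA tak mulgA tak -mulgA.
  by rewrite mulnA.
elim: n => [|n IH]; first by rewrite expn0 expg0 expg1 mulg1 mul1g.
by rewrite expgS -mulgA IH mulgA tauak -mulgA expnS.
Qed.

(** All vertices of the closed path have this form with x, k natural. *)
Definition corner (x k : nat) : vert (cayley bs_gens) :=
  (bs_a ^+ x * bs_tau ^+ k)%g : BS12.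

Lemma affine_corner x k : affine (corner x k) x%:R (2 * k)%N.
Proof.
have tau_act (g : BS12) y l : affine g y l -> affine (g * bs_tau)%g y (l + 2).
  move=> gy; rewrite /bs_tau expg2 mulgA -[2]/(1 + 1) addrA.
  by do 2!apply: affine_t.
rewrite /corner; elim: k => [|k IH].
  rewrite muln0 expg0 mulg1; elim: x => [|x IH].
    by move=> y; rewrite expg0 bs_act1 expr0z mul1r addr0.
  by rewrite expgSr -natr1; apply: affine_a.
by rewrite expgSr mulgA mulnS addnC PoszD; apply: tau_act.
Qed.

Lemma adjacent_gen (g s : BS12) : bs_gens s ->
  @adjacent (cayley bs_gens) g (g * s)%g.
Proof. by move=> sS; exists ((g, SigSub (mem_set sS)), true). Qed.

Lemma adjacent_up x k : adjacent (corner x k) (corner x k.+1).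
Proof. by rewrite /corner expgSr mulgA; apply: adjacent_gen; right. Qed.

Lemma adjacent_right x k : adjacent (corner x k) (corner (x + 4 ^ k) k).
Proof.
by rewrite /corner expgnDr -mulgA -bs_tau_a mulgA; apply: adjacent_gen; left; left.
Qed.

Lemma corner_walk_length n x x' k L : (1 < n)%N -> odd (x + x') ->
  (4 ^ n <= (x' - x) + (x - x') + 1)%N ->
  walk (corner x k) (corner x' k) L -> (2 * n + 2 <= L)%N.
Proof.
move=> n1 xx' far.
have diffE : x'%:R - x%:R = (x'%:Z - x%:Z)%:~R :> rat by rewrite rmorphB.
apply: odd_walk_length (affine_corner _ _) (affine_corner _ _) _ _ => //.
- have e := odd_double_half (x + x'); rewrite xx' -muln2 in e.
  rewrite diffE (_ : x'%:Z - x%:Z = 2 * ((x + x')./2%:Z - x%:Z) + 1) //; lia.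
- rewrite diffE -intr_norm lerBlDr -natrX -[1]/(1%:~R) -rmorphD /=.
  by rewrite -[(4 ^ n)%:R]/((4 ^ n)%:Z%:~R) ler_int; lia.
Qed.

Section Commutator.
Variable n : nat.

(** Position i of the closed path is j = i mod m in the first or the second
    half, which the boolean b = false, true tells.  In each half, the path climbs
    from height 0 to 2n by tau, makes the a-edge at height 2n between j = n and
    j = n + 1, descends, and makes an a-edge at height 0 to enter the other half;
    [hi] tells that the upper a-edge has been made, and [height] counts in units
    of tau.  The x coordinate is successively 0, 4^n, 4^n + 1, 1.  Indexing by
    halves makes passing to the antipode a change of b only. *)
Definition shift (b hi : bool) : nat :=
  (if b then if hi then 1 else (4 ^ n).+1 else if hi then 4 ^ n else 0)%N.
Definition height (j : nat) : nat := if (n < j)%N then (2 * n + 1 - j)%N else j.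

Definition commutator_vertex (i : nat) :=
  let j := (i %% (2 * n + 2))%N in
  corner (shift (odd (i %/ (2 * n + 2))) (n < j)%N) (height j).

Lemma commutator_vertexE q j : (j < 2 * n + 2)%N ->
  commutator_vertex (q * (2 * n + 2) + j) =
  corner (shift (odd q) (n < j)%N) (height j).
Proof.
move=> jm; rewrite /commutator_vertex modnMDl divnMDl ?addn2 //.
by rewrite -addn2 modn_small // divn_small // addn0.
Qed.

Lemma commutator_vertex_periodic i :
  commutator_vertex (i + (2 * n + 2).*2) = commutator_vertex i.
Proof.
rewrite (divn_eq i (2 * n + 2)) addnAC -mul2n -mulnDl.
have jm := ltn_pmod i (ltac:(lia) : 0 < 2 * n + 2)%N.
by rewrite !commutator_vertexE // oddD addbF.
Qed.

Lemma commutator_vertex_adjacent i :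
  adjacent (commutator_vertex i) (commutator_vertex i.+1).
Proof.
rewrite (divn_eq i (2 * n + 2)).
have jm := ltn_pmod i (ltac:(lia) : 0 < 2 * n + 2)%N.
move: (i %/ _)%N (i %% _)%N jm => q j jm.
rewrite commutator_vertexE // -addnS.
have [jm'|jm'] := ltnP j.+1 (2 * n + 2); last first.
  have -> : (q * (2 * n + 2) + j.+1 = q.+1 * (2 * n + 2) + 0)%N by lia.
  rewrite commutator_vertexE ?addn2 // /height /shift.
  have -> : (n < j)%N by lia.
  have -> : (2 * n + 1 - j = 0)%N by lia.
  rewrite /=; case: (odd q) => /=.
    exact/adjacent_sym/(adjacent_right 0 0).
  by have := adjacent_right (4 ^ n) 0; rewrite expn0 addn1.
rewrite commutator_vertexE // /height.
have [jn|nj|->] := ltngtP j n.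
- by rewrite ltnNge jn; exact: adjacent_up.
- rewrite ltnW //.
  have -> : (2 * n + 1 - j = (2 * n + 1 - j.+1).+1)%N by lia.
  exact/adjacent_sym/adjacent_up.
rewrite ltnSn.
have -> : (2 * n + 1 - n.+1 = n)%N by lia.
rewrite /shift; case: (odd q); last exact: (adjacent_right 0 n).
by apply: adjacent_sym; have := adjacent_right 1 n; rewrite add1n.
Qed.

(** Antipodes have the same height, and shifts 0 and 4^n + 1, or 4^n and 1. *)
Lemma commutator_vertex_far i L : (1 < n)%N ->
  walk (commutator_vertex i) (commutator_vertex (i + (2 * n + 2))) L ->
  (2 * n + 2 <= L)%N.
Proof.
move=> n_gt1; rewrite (divn_eq i (2 * n + 2)) addnAC -mulSnr.
have jm := ltn_pmod i (ltac:(lia) : 0 < 2 * n + 2)%N.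
rewrite !commutator_vertexE //; apply: corner_walk_length => //.
  have odd4 : odd (4 ^ n) = false by rewrite oddX; case: (n) n_gt1.
  by rewrite /shift oddS; case: (odd (i %/ _)); case: (n < _)%N; rewrite oddD /= odd4.
by rewrite /shift /=; case: (odd _); case: (n < _)%N => /=; lia.
Qed.

End Commutator.

Theorem theorem7p18 (R : realType) : ~ @shortcut R BS12_cayley.
Proof.
case=> theta bound.
pose n := theta.+2.
have far i L := @commutator_vertex_far n i L isT.
have [f [C_cycle f_cycle f_iso]] := @antipodal_isometric_cycle R
  BS12_cayley _ (commutator_vertex n) (ltac:(lia) : 1 < 2 * n + 2)%N
  (commutator_vertex_periodic n) (commutator_vertex_adjacent n) far.
have := bound _ f C_cycle f_cycle f_iso.
by rewrite -(card_le_eql card_II) card_le_II; lia.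
Qed.
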